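(* Let $n\ge 0$ be an integer, let $c_0\in\mathbb{R}$, and let $p,q$ be the strict Laurent polynomials with integer coefficients such that $j_n(x)=p(x)\sin x+q(x)\cos x$ for all real $x\neq 0$, where $j_n$ is the spherical Bessel function of the first kind. Let $x_{n,m}$ denote the $m$-th infsupum abscissa of $j_n$, and let $B$ be the set of all real branch numbers $b$ of $\mathrm{inverse}_b(j_n)$ for which the interval with endpoints $j_n(x_{n,b-1})$ and $j_n(x_{n,b})$ (the first endpoint included, the second excluded) contains $c_0$. Then the set of all real solutions $x$ of the equation $$p(x)\sin x+q(x)\cos x=c_0,$$ where the left side is understood to have the value $1$ at $x=0$ if $n=0$ and the value $0$ at $x=0$ if $n>0$, is exactly $$\{\,\mathrm{inverse}_b(j_n)(c_0) : b\in B\,\}$$ (which is empty if $B$ is empty).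
   Context: A strict univariate Laurent polynomial is either $0$ or a finite sum of terms, each a numeric coefficient times a negative integer power of the variable. For integer $n\ge 0$, $j_n(x)=(-x)^n\left(\frac1x\frac{d}{dx}\right)^n\frac{\sin x}{x}$ for real $x\ne 0$, with $j_0(0)=1$ and $j_n(0)=0$ for $n>0$. Equivalently, for $x\neq 0$, $j_0(x)=\frac{\sin x}{x}$, $j_1(x)=\frac{\sin x}{x^2}-\frac{\cos x}{x}$, and $j_{n+1}(x)=\frac{2n+1}{x}j_n(x)-j_{n-1}(x)$. For $x\ne0$ each $j_n$ is thus of the form $p(x)\sin x+q(x)\cos x$ with $p,q$ strict Laurent polynomials with integer coefficients. Infsupum abscissas and branches of a function $f$: the real line is partitioned into maximal intervals on which $f$ is continuous and monotonic. The endpoints of these intervals (abscissas of local infima and suprema of $f$) are called the infsupum abscissas. They are numbered consecutively in increasing order by integers $m$, so that number $1$ is the least positive one, those to its right are $2,3,\dots$, and those to its left are $0,-1,\dots$. Branch number $b$ is the interval $[x_{n,b-1},x_{n,b})$. For $c$ in the image of branch interval $b$ under $f$, $\mathrm{inverse}_b(f)(c)$ denotes the unique $x$ in branch interval $b$ with $f(x)=c$. *)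

(* Defs.v *)
From HB Require Import structures.
From mathcomp Require Import all_boot all_order all_algebra.
From mathcomp Require Import all_classical all_reals all_analysis.

Set Implicit Arguments.
Unset Strict Implicit.
Unset Printing Implicit Defensive.

Import Order.TTheory GRing.Theory Num.Theory.
Import numFieldNormedType.Exports.

Local Open Scope classical_set_scope.
Local Open Scope ring_scope.

(* Strict Laurent polynomials with integer coefficients are encoded by
   {poly int}: the coefficient of index i of P is that of x^-(i+1). *)
Definition strict_laurent (R : realType) (P : {poly int}) (x : R) : R :=
  \sum_(i < size P) (P`_i)%:~R * x ^- i.+1.

(* Rayleigh's formula; the derivative at x != 0 is local, hence does not
   depend on the value of sin y / y at y = 0. *)
Definition spherical_bessel (R : realType) (n : nat) (x : R) : R :=
  if x == 0 then (if n == 0%N then 1 else 0)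
  else (- x) ^+ n *
       iter n (fun (f : R -> R) y => y^-1 * derive1 f y)
         (fun y => sin y / y) x.

Definition monotonic_on (R : realType) (f : R -> R) (I : interval R) : Prop :=
  {in I &, {homo f : x y / x <= y}} \/ {in I &, {homo f : x y /~ x <= y}}.

Definition continuous_monotonic_on (R : realType) (f : R -> R)
    (I : interval R) : Prop :=
  {within [set` I], continuous f} /\ monotonic_on f I.

Definition maximal_continuous_monotonic (R : realType) (f : R -> R)
    (I : interval R) : Prop :=
  continuous_monotonic_on f I /\
  forall J : interval R, continuous_monotonic_on f J ->
    [set` I] `<=` [set` J] -> [set` J] `<=` [set` I].

(* Only finite endpoints count; whether I contains them is irrelevant. *)
Definition interval_endpoint (R : realType) (I : interval R) (a : R) : Prop :=
  exists side : bool, I.1 = BSide side a \/ I.2 = BSide side a.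

Definition infsupum_abscissas (R : realType) (f : R -> R) : set R :=
  [set a | exists2 I : interval R,
     maximal_continuous_monotonic f I & interval_endpoint I a].

(* Being numbered consecutively in increasing order is expressed by a
   strictly increasing map onto the set of abscissas. *)
Definition infsupum_numbering (R : realType) (f : R -> R) (x : int -> R) :
    Prop :=
  [/\ {homo x : k m / k < m},
      range x = infsupum_abscissas f,
      0 < x 1 &
      forall a, infsupum_abscissas f a -> 0 < a -> x 1 <= a].

(* There is at most one numbering; it exists when the abscissas are locally
   finite and unbounded on both sides.  Otherwise the value is junk. *)
Definition infsupum (R : realType) (f : R -> R) : int -> R :=
  xget (fun=> 0) [set x | infsupum_numbering f x].

Definition branch (R : realType) (f : R -> R) (b : int) : interval R :=
  `[infsupum f (b - 1), infsupum f b[.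

(* Definite description; junk value 0 if there is no unique such x. *)
Definition branch_inverse (R : realType) (b : int) (f : R -> R) (c : R) : R :=
  xget 0 [set x | unique (fun y => y \in branch f b /\ f y = c) x].

(* The interval with endpoints u (included) and v (excluded), in either
   order. *)
Definition directed_itv (R : realType) (u v : R) : interval R :=
  if u <= v then `[u, v[ else `]v, u].

Definition solution_branches (R : realType) (f : R -> R) (c : R) : set int :=
  [set b | c \in directed_itv (f (infsupum f (b - 1))) (f (infsupum f b))].

(* Main.v *)
Require Import Defs.
From HB Require Import structures.
From mathcomp Require Import all_boot all_order all_algebra.
From mathcomp Require Import all_classical all_reals all_analysis.
From mathcomp Require Import ring lra zify.

Set Implicit Arguments.
Unset Strict Implicit.
Unset Printing Implicit Defensive.

Import Order.TTheory GRing.Theory Num.Theory.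
Import numFieldNormedType.Exports.

Local Open Scope classical_set_scope.
Local Open Scope ring_scope.

(** Nothing in the statement is special to Bessel functions beyond four
    properties, collected in [oscillating]: continuity, injectivity on a short
    interval on either side of every point, and failure of monotonicity on every
    half-line in both directions.

    For such a function f, take a short interval on which f is monotonic.  The
    union of all the intervals of monotonicity that contain it is a maximal one,
    because two intervals of monotonicity sharing two points at which f differs
    have the same direction and can be glued together ([monotonic_on_glue]).  It
    is bounded, so its two ends are abscissas, and the same gluing shows that no
    abscissa lies between them.  Hence every real number has a next and a
    previous abscissa ([next_abscissa], [previous_abscissa]); iterating these
    reaches every abscissa, since a bounded strictly increasing sequence of
    abscissas would leave its limit without a previous one ([enumerate_above]).
    So a numbering exists, the branches cover the line, and f is strictly
    monotonic on the closure of each branch.  The claim then follows from the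
    intermediate value theorem ([oscillating_solutions]).

    To see that j_n is of this kind, write sin x = x K_0(x^2) with
    K_0(u) = sum_k (-1)^k u^k / (2k+1)!, and let K_n be the n-th derivative of
    K_0.  Since (1/x) d/dx K(x^2) = 2 K'(x^2), Rayleigh's formula becomes
    j_n(x) = (-2x)^n K_n(x^2), which is valid at 0 as well
    ([spherical_besselE]); here K_n is [bessel_series n].  Consequently
    j_n'(x) = (-2x)^n / x * G(x^2) for x <> 0, where G(u) = n K_n(u) +
    2 u K_{n+1}(u).  Injectivity near a point needs the zeros of G to be
    isolated on u >= 0.  By Rolle, G, G' and G'' vanish at a point of
    accumulation of zeros of G; together with the recurrence
    4 u K_{n+2} + (4n+6) K_{n+1} + K_n = 0 this forces K_n = K_{n+1} = 0 there,
    and descending the recurrence gives K_0 = K_1 = 0, that is sin x = cos x = 0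
    with x^2 = u, which is absurd ([bessel_slope_isolated]).  Finally K_0
    vanishes at (k pi)^2, so by Rolle each K_n has arbitrarily large zeros
    ([bessel_series_zeros_unbounded]), and a function that is monotonic on a
    half-line and has arbitrarily distant zeros there is eventually constant,
    contrary to local injectivity. *)

(** * Monotonicity on intervals *)

Lemma monotonic_onP (R : realType) (f : R -> R) (I : interval R) :
  monotonic_on f I <->
  (forall x y, x \in I -> y \in I -> x <= y -> f x <= f y) \/
  (forall x y, x \in I -> y \in I -> x <= y -> f y <= f x).
Proof.
split=> -[h|h]; [left|right|left|right].
- by move=> x y xI yI; exact: h.
- by move=> x y xI yI; exact: h.
- by move=> x y xI yI; exact: h.
- by move=> x y xI yI; exact: h.
Qed.

Lemma monotonic_onS (R : realType) (f : R -> R) (I J : interval R) :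
  [set` I] `<=` [set` J] -> monotonic_on f J -> monotonic_on f I.
Proof.
by move=> IJ [h|h]; [left|right] => x y /IJ xJ /IJ yJ; exact: h.
Qed.

Lemma itv_convex (R : realType) (I : interval R) (x y z : R) :
  x \in I -> y \in I -> x <= z -> z <= y -> z \in I.
Proof.
by move=> xI yI xz zy; apply: (@interval_is_interval _ I x y) => //; rewrite xz.
Qed.

Lemma itv_ge_left (R : realType) (I : interval R) (c : bool) (a x : R) :
  I.1 = BSide c a -> x \in I -> a <= x.
Proof.
case: I => l r /= ->; rewrite itv_boundlr => /andP[ax _].
by case: c ax => /= [|/ltW].
Qed.

Lemma itv_le_right (R : realType) (I : interval R) (c : bool) (b x : R) :
  I.2 = BSide c b -> x \in I -> x <= b.
Proof.
case: I => l r /= ->; rewrite itv_boundlr => /andP[_ xb].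
by case: c xb => /= [/ltW|].
Qed.

Lemma itv_gt_left (R : realType) (I : interval R) (c : bool) (a x y : R) :
  I.1 = BSide c a -> y \in I -> a < x -> x <= y -> x \in I.
Proof.
case: I => l r /= ->; rewrite !itv_boundlr => /andP[_ yr] ax xy.
apply/andP; split; last by apply: le_trans yr.
by case: c => //=; exact: ltW.
Qed.

Lemma itv_lt_right (R : realType) (I : interval R) (c : bool) (b x y : R) :
  I.2 = BSide c b -> y \in I -> y <= x -> x < b -> x \in I.
Proof.
case: I => l r /= ->; rewrite !itv_boundlr => /andP[ly _] yx xb.
apply/andP; split; first by apply: le_trans ly _.
by case: c => //=; exact: ltW.
Qed.

(** Stated for a transitive relation [r] so as to serve both directions of
    monotonicity.  One common point [v] suffices: a pair of points in different
    intervals either straddles [v] or, by convexity, lies in one of them. *)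
Lemma homo_glue (R : realType) (r : rel R) (f : R -> R) (I J K : interval R)
    (v : R) : transitive r ->
  v \in I -> v \in J -> [set` K] `<=` [set` I] `|` [set` J] ->
  (forall x y, x \in I -> y \in I -> x <= y -> r (f x) (f y)) ->
  (forall x y, x \in J -> y \in J -> x <= y -> r (f x) (f y)) ->
  forall x y, x \in K -> y \in K -> x <= y -> r (f x) (f y).
Proof.
move=> rt vI vJ KIJ rI rJ x y xK yK xy.
have half (A B : interval R) : v \in A -> v \in B ->
    (forall x y, x \in A -> y \in A -> x <= y -> r (f x) (f y)) ->
    (forall x y, x \in B -> y \in B -> x <= y -> r (f x) (f y)) ->
    x \in A -> y \in B -> r (f x) (f y).
  move=> vA vB rA rB xA yB; have [xv|vx] := leP x v; last first.
    by apply: rB => //; apply: (itv_convex vB yB) => //; exact: ltW.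
  have [vy|yv] := leP v y; first by apply: rt (rA _ _ _ _ xv) (rB _ _ _ _ vy).
  by apply: rA => //; apply: (itv_convex xA vA) => //; exact: ltW.
have [xI|xJ] := KIJ _ xK; have [yI|yJ] := KIJ _ yK.
- exact: rI.
- exact: (half I J).
- exact: (half J I).
- exact: rJ.
Qed.

(** Without two common points that [f] separates, [f] could increase on [I] and
    decrease on [J]. *)
Lemma monotonic_on_glue (R : realType) (f : R -> R) (I J K : interval R)
    (u v : R) :
  u \in I -> v \in I -> u \in J -> v \in J -> u <= v -> f u != f v ->
  [set` K] `<=` [set` I] `|` [set` J] ->
  monotonic_on f I -> monotonic_on f J -> monotonic_on f K.
Proof.
move=> uI vI uJ vJ uv fuv KIJ /monotonic_onP hI /monotonic_onP hJ.
have absurd : f u <= f v -> f v <= f u -> monotonic_on f K.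
  by move=> fle fge; move: fuv; rewrite eq_le fle fge.
apply/monotonic_onP; case: hI hJ => [hI|hI] [hJ|hJ].
- by left; exact: (homo_glue (r := <=%R) le_trans vI vJ).
- by apply/monotonic_onP/absurd; [exact: hI|exact: hJ].
- by apply/monotonic_onP/absurd; [exact: hJ|exact: hI].
- right; apply: (homo_glue (r := >=%R) _ vI vJ) => // y x z xy yz.
  exact: le_trans yz xy.
Qed.

(** A failure of each of the two directions is witnessed by two pairs of points,
    and a single segment contains all four points. *)
Lemma monotonic_on_segments (R : realType) (f : R -> R) (I : interval R) :
  (forall x y, x \in I -> y \in I -> x <= y -> monotonic_on f `[x, y]) ->
  monotonic_on f I.
Proof.
move=> h; apply: contrapT => /monotonic_onP/not_orP[].
move=> /existsNP[x1 /existsNP[y1 /not_implyP[x1I /not_implyP[y1I]]]].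
move=> /not_implyP[xy1 /negP f1].
move=> /existsNP[x2 /existsNP[y2 /not_implyP[x2I /not_implyP[y2I]]]].
move=> /not_implyP[xy2 /negP f2].
have xI : Num.min x1 x2 \in I by case: (leP x1 x2).
have yI : Num.max y1 y2 \in I by case: (leP y1 y2).
have in12 z : Num.min x1 x2 <= z -> z <= Num.max y1 y2 ->
    z \in `[Num.min x1 x2, Num.max y1 y2] by rewrite in_itv /= => -> ->.
have x1x : Num.min x1 x2 <= x1 by rewrite ge_min lexx.
have x2x : Num.min x1 x2 <= x2 by rewrite ge_min lexx orbT.
have y1y : y1 <= Num.max y1 y2 by rewrite le_max lexx.
have y2y : y2 <= Num.max y1 y2 by rewrite le_max lexx orbT.
have := h _ _ xI yI (le_trans x1x (le_trans xy1 y1y)).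
move=> /monotonic_onP[up|down].
- move: f1; rewrite up ?in12//; [exact: le_trans y1y|exact: le_trans xy1].
- move: f2; rewrite down ?in12//; [exact: le_trans y2y|exact: le_trans xy2].
Qed.

(** If g x > g y with x < y, continuity keeps the strict inequality when x and y
    are moved slightly towards each other, hence off the ends of the interval. *)
Lemma monotonic_on_closure (R : realType) (f : R -> R) (a b : R) :
  continuous f -> monotonic_on f `]a, b[ -> monotonic_on f `[a, b].
Proof.
have up (g : R -> R) : continuous g ->
    (forall x y, x \in `]a, b[ -> y \in `]a, b[ -> x <= y -> g x <= g y) ->
    forall x y, x \in `[a, b] -> y \in `[a, b] -> x <= y -> g x <= g y.
  move=> cg h x y; rewrite !in_itv /= => /andP[ax _] /andP[_ yb] xy.
  rewrite leNgt; apply/negP => gyx.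
  have xy' : x < y.
    by rewrite lt_neqAle xy andbT; apply/eqP => E; rewrite E ltxx in gyx.
  pose m := (g x + g y) / 2.
  have /nbhs_ballP[d d0 hd] : \forall z \near x, m < g z.
    by apply: (cvgr_gt _ (cg x)); rewrite /m; lra.
  have /nbhs_ballP[e e0 he] : \forall z \near y, g z < m.
    by apply: (cvgr_lt _ (cg y)); rewrite /m; lra.
  pose k := Num.min (Num.min d e) (y - x) / 3.
  have k0 : 0 < k by rewrite divr_gt0// !lt_min d0 e0 subr_gt0.
  have kd : 3 * k <= d by rewrite mulrC divfK// !ge_min lexx.
  have ke : 3 * k <= e by rewrite mulrC divfK// !ge_min lexx orbT.
  have kxy : 3 * k <= y - x by rewrite mulrC divfK// ge_min lexx orbT.
  have mx : m < g (x + k).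
    by apply: hd; rewrite /ball /= opprD addNKr normrN gtr0_norm//; lra.
  have my : g (y - k) < m.
    by apply: he; rewrite /ball /= opprB addrCA subrr addr0 gtr0_norm//; lra.
  have := h (x + k) (y - k); rewrite !in_itv /= [g _ <= _]leNgt (lt_trans my mx).
  have -> : a < x + k < b by apply/andP; split; lra.
  have -> : a < y - k < b by apply/andP; split; lra.
  have -> : x + k <= y - k by lra.
  by move=> /(_ isT isT isT).
move=> cf /monotonic_onP h; apply/monotonic_onP; case: h => h.
  by left; exact: up.
right=> x y xI yI xy; rewrite -lerN2.
apply: (up (fun z => - f z)) => // [z|x' y' *]; last by rewrite lerN2 h.
by apply: cvgN; exact: cf.
Qed.

(** * Functions with isolated turning points *)

Definition oscillating (R : realType) (f : R -> R) : Prop :=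
  [/\ continuous f,
      forall a, exists2 e, 0 < e &
        {in `[a, a + e] &, injective f} /\ {in `[a - e, a] &, injective f},
      forall a, ~ monotonic_on f `[a, +oo[ &
      forall a, ~ monotonic_on f `]-oo, a]].

Lemma oscillating_neq (R : realType) (f : R -> R) (s t : R) :
  oscillating f -> s < t -> exists u v, [/\ s <= u, u < v, v <= t & f u != f v].
Proof.
move=> [_ inj _ _] st; have [e e0 [injr _]] := inj s.
exists s, (Num.min t (s + e)).
have sv : s < Num.min t (s + e) by rewrite lt_min st ltrDl.
split=> //; first by rewrite ge_min lexx.
have sI : s \in `[s, s + e] by rewrite in_itv /= lexx lerDl ltW.
have vI : Num.min t (s + e) \in `[s, s + e].
  by rewrite in_itv /= (ltW sv) ge_min lexx orbT.
by apply/eqP => /(injr _ _ sI vI) E; rewrite -E ltxx in sv.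
Qed.

Lemma oscillating_locally_monotonic (R : realType) (f : R -> R) (a : R) :
  oscillating f ->
  exists2 e, 0 < e & monotonic_on f `[a, a + e] /\ monotonic_on f `[a - e, a].
Proof.
move=> [cf inj _ _]; have [e e0 [injr injl]] := inj a; exists e => //.
by split; apply: unstable.strict_monotonicW; apply: itv_continuous_inj_mono => //;
  exact: continuous_subspaceT.
Qed.

(** The maximal interval is the union [U] of all the intervals of monotonicity
    containing [s] and [t]: as [f] takes two distinct values on [[s, t]], they
    all have the same direction. *)
Lemma monotonic_on_extend (R : realType) (f : R -> R) (s t : R) :
  oscillating f -> s < t -> monotonic_on f `[s, t] ->
  exists a b, [/\ a <= s, t <= b, monotonic_on f `[a, b],
    infsupum_abscissas f a & infsupum_abscissas f b].
Proof.
move=> osc st mst; have [cf _ noR noL] := osc.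
have [u [v [su uv vt fuv]]] := oscillating_neq osc st.
pose U : set R := [set y | exists I : interval R,
  [/\ monotonic_on f I, s \in I, t \in I & y \in I]].
have Us : U s by exists `[s, t]; split; rewrite ?in_itv /= ?lexx ?(ltW st).
have Ut : U t by exists `[s, t]; split; rewrite ?in_itv /= ?lexx ?(ltW st).
have Uitv : is_interval U.
  move=> x y [I [mI sI tI xI]] [J [mJ sJ tJ yJ]] z /andP[xz zy].
  have [zs|sz] := leP z s.
    by exists I; split => //; exact: (itv_convex xI sI).
  by exists J; split => //; apply: (itv_convex sJ yJ) => //; exact: ltW.
have UE : [set` Rhull U] = U by apply: RhullK; rewrite inE.
have inU x : (x \in Rhull U) = true <-> U x by rewrite -{2}UE.
have mU : monotonic_on f (Rhull U).
  apply: monotonic_on_segments => x y /inU[I [mI sI tI xI]] /inU[J [mJ sJ tJ yJ]] xy.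
  have inst (K : interval R) w : s \in K -> t \in K -> s <= w -> w <= t -> w \in K.
    by move=> sK tK; exact: (itv_convex sK tK).
  have su' := le_trans su (ltW uv); have vt' := le_trans (ltW uv) vt.
  apply: (@monotonic_on_glue _ f I J _ u v) => //; try exact: inst; first exact: ltW.
  move=> z /=; rewrite in_itv /= => /andP[xz zy].
  have [zs|sz] := leP z s; first by left; exact: (itv_convex xI sI).
  by right; apply: (itv_convex sJ yJ) => //; exact: ltW.
have maxU : maximal_continuous_monotonic f (Rhull U).
  split; first by split => //; exact: continuous_subspaceT.
  move=> J [_ mJ]; rewrite UE => UJ y yJ; exists J; split => //; exact: UJ.
move: Us Ut => /inU sU /inU tU.
(* An infinite end would make [f] monotonic on a half-line. *)
have [c1 [a E1]] : exists c a, (Rhull U).1 = BSide c a.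
  case E : (Rhull U) sU mU => [[c a|[]] c'] sU mU //; first by exists c, a.
  case: (noL s); apply: monotonic_onS mU => x /=; rewrite in_itv /= => xs.
  by rewrite itv_boundlr /= in sU *; apply: le_trans sU.
have [c2 [b E2]] : exists c b, (Rhull U).2 = BSide c b.
  case E : (Rhull U) tU mU => [c' [c b|[]]] tU mU; first by exists c, b.
    by move: tU; rewrite itv_boundlr andbF.
  case: (noR t); apply: monotonic_onS mU => x /=; rewrite in_itv andbT /= => tx.
  by rewrite !itv_boundlr !andbT in tU *; apply: le_trans tU _.
exists a, b; split.
- exact: itv_ge_left E1 sU.
- exact: itv_le_right E2 tU.
- apply: monotonic_on_closure => //; apply: monotonic_onS mU => x /=.
  rewrite in_itv /= => /andP[ax xb]; have [xs|sx] := leP x s.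
    exact: itv_gt_left E1 sU ax xs.
  exact: itv_lt_right E2 sU (ltW sx) xb.
- by exists (Rhull U) => //; exists c1; left.
- by exists (Rhull U) => //; exists c2; right.
Qed.

(** A maximal interval ending at [s] leaves [s] on one side, where it overlaps
    [[a, b]] in a nondegenerate interval or else stays inside [[a, b]].  In both
    cases maximality makes it contain [[a, b]], so [s] was not its end. *)
Lemma no_abscissa_inside (R : realType) (f : R -> R) (a b s : R) :
  oscillating f -> monotonic_on f `[a, b] -> infsupum_abscissas f s ->
  a < s -> s < b -> False.
Proof.
move=> osc mab [I [[cI mI] maxI] [c sI]] as_ sb; have [cf _ _ _] := osc.
have cm J : monotonic_on f J -> continuous_monotonic_on f J.
  by move=> mJ; split=> //; exact: continuous_subspaceT.
suff abI : [set` `[a, b]] `<=` [set` I].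
  have aI : a \in I by apply: abI; rewrite /= in_itv /= lexx ltW// (lt_trans as_).
  have bI : b \in I by apply: abI; rewrite /= in_itv /= lexx andbT ltW// (lt_trans as_).
  case: sI => E.
    by have := itv_ge_left E aI; rewrite leNgt as_.
  by have := itv_le_right E bI; rewrite leNgt sb.
have overlap u v : u \in I -> v \in I -> a <= u -> u < v -> v <= b ->
    [set` `[a, b]] `<=` [set` I].
  move=> uI vI au uv vb.
  have [u' [v' [uu' uv' vv' fuv]]] := oscillating_neq osc uv.
  pose U := [set` `[a, b]] `|` [set` I].
  have UE : [set` Rhull U] = U.
    apply: RhullK; rewrite inE.
    have ua : u \in `[a, b] by rewrite in_itv /= au; lra.
    have half (J K : interval R) x y z : u \in J -> u \in K ->
        x \in J -> y \in K -> x <= z -> z <= y -> z \in J \/ z \in K.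
      move=> uJ uK xJ yK xz zy; have [zu|uz] := leP z u.
        by left; exact: (itv_convex xJ uJ).
      by right; apply: (itv_convex uK yK) => //; exact: ltW.
    move=> x y [xJ|xI] [yJ|yI] z /andP[xz zy].
    - by left; exact: (itv_convex xJ yJ).
    - exact: (half `[a, b] I x y).
    - by have [?|?] := half I `[a, b] x y z uI ua xI yJ xz zy; [right|left].
    - by right; exact: (itv_convex xI yI).
  have IU : [set` I] `<=` [set` Rhull U] by rewrite UE => x; right.
  have /maxI/(_ IU) : continuous_monotonic_on f (Rhull U).
    apply/cm/(@monotonic_on_glue _ f `[a, b] I _ u' v'); rewrite ?UE//.
    - by rewrite in_itv /=; lra.
    - by rewrite in_itv /=; lra.
    - by apply: (itv_convex uI vI); lra.
    - by apply: (itv_convex uI vI); lra.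
    - exact: ltW.
  by rewrite UE => UI x xab; apply: UI; left.
have [IJ|] := pselect ([set` I] `<=` [set` `[a, b]]).
  exact: maxI (cm _ mab) IJ.
move=> /existsNP[w /not_implyP[/= wI wab]].
have {wab} wab : w < a \/ b < w.
  by case: (ltP w a) => [|aw]; [left|right; rewrite ltNge; apply/negP => wb;
    apply: wab; rewrite /= in_itv /= aw].
case: sI => E.
- have sw := itv_ge_left E wI; pose m := (s + b) / 2.
  by apply: (overlap m b); rewrite /m; try (apply: (itv_gt_left E wI)); lra.
- have sw := itv_le_right E wI; pose m := (a + s) / 2.
  by apply: (overlap a m); rewrite /m; try (apply: (itv_lt_right E wI)); lra.
Qed.

(** The right end of the maximal interval that extends a short interval
    [[a, a + e]]. *)
Lemma next_abscissa (R : realType) (f : R -> R) (a : R) : oscillating f ->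
  exists b, [/\ infsupum_abscissas f b, a < b, monotonic_on f `[a, b] &
    forall c, infsupum_abscissas f c -> a < c -> b <= c].
Proof.
move=> osc; have [e e0 [me _]] := oscillating_locally_monotonic a osc.
have aae : a < a + e by rewrite ltrDl.
have [a' [b [a'a aeb mab _ Sb]]] := monotonic_on_extend osc aae me.
exists b; split => //; first exact: lt_le_trans aeb.
  by apply: monotonic_onS mab => x /=; rewrite !in_itv /= => /andP[ax ->];
    rewrite (le_trans a'a ax).
move=> c Sc ac; rewrite leNgt; apply/negP => cb.
exact: no_abscissa_inside mab Sc (le_lt_trans a'a ac) cb.
Qed.

(** The left end of the maximal interval that extends [[a - e, a]]. *)
Lemma previous_abscissa (R : realType) (f : R -> R) (a : R) : oscillating f ->
  exists b, [/\ infsupum_abscissas f b, b < a &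
    forall c, infsupum_abscissas f c -> c < a -> c <= b].
Proof.
move=> osc; have [e e0 [_ me]] := oscillating_locally_monotonic a osc.
have aea : a - e < a by rewrite ltrBlDr ltrDl.
have [b [a' [bae aa' mab Sb _]]] := monotonic_on_extend osc aea me.
exists b; split => //; first exact: le_lt_trans aea.
move=> c Sc ca; rewrite leNgt; apply/negP => bc.
exact: no_abscissa_inside mab Sc bc (lt_le_trans ca aa').
Qed.

(** * Numbering the abscissas and solving on each branch *)

(** Iterating the passage to the next element from [a] cannot skip an element of [S], and cannot
    stay below some [z]: the supremum of the sequence would have a previous
    element in [S], which some term of the sequence exceeds. *)
Lemma enumerate_above (R : realType) (S : set R) (a : R) :
  (forall x, exists y, [/\ S y, x < y & forall z, S z -> x < z -> y <= z]) ->
  (forall x, exists y, [/\ S y, y < x & forall z, S z -> z < x -> z <= y]) ->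
  exists u : nat -> R, [/\ {homo u : m n / (m < n)%N >-> m < n},
    forall n, S (u n), forall n, a < u n &
    forall z, S z -> a < z -> exists n, u n = z].
Proof.
move=> /choice[nx nxP] prev.
pose u n := iter n.+1 nx a.
have uS n : u n < u n.+1 by have [_ ] := nxP (u n).
have au n : a < u n.
  elim: n => [|n IHn]; first by have [_ ] := nxP a.
  exact: lt_trans (uS n).
have Su n : S (u n) by have [] := nxP (iter n nx a).
have nextu n z : S z -> u n < z -> u n.+1 <= z by have [_ _] := nxP (u n); apply.
exists u; split => //; first exact: homo_ltn lt_trans uS.
move=> z Sz az.
have [N zN] : exists n, z <= u n.
  apply: contrapT => noN.
  have uz n : u n < z by rewrite ltNge; apply/negP => zu; apply: noN; exists n.
  have hs : has_sup (range u).
    by split; [exists (u 0%N); exists 0%N|exists z => _ [n _ <-]; exact: ltW].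
  have [p [Sp pL prevp]] := prev (sup (range u)).
  have [|_ [n _ <-]] := @sup_adherent _ _ (sup (range u) - p) _ hs.
    by rewrite subr_gt0.
  rewrite opprB addrCA subrr addr0 => pu.
  have : u n <= p.
    apply: prevp => //; apply: lt_le_trans (uS n) _.
    by apply: ub_le_sup; [case: hs|exists n.+1].
  by rewrite leNgt pu.
have exN : exists n, z <= u n by exists N.
have [[|m] zm minm] := ex_minnP exN.
  exists 0%N; apply/eqP; rewrite eq_le zm andbT.
  by have [_ _ ] := nxP a; apply.
exists m.+1; apply/eqP; rewrite eq_le zm andbT; apply: nextu => //.
by rewrite ltNge; apply/negP => /minm; rewrite ltnn.
Qed.

Lemma infsupum_numbering_exists (R : realType) (f : R -> R) :
  oscillating f -> exists x, infsupum_numbering f x.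
Proof.
move=> osc; set S := infsupum_abscissas f.
have next x : exists y, [/\ S y, x < y & forall z, S z -> x < z -> y <= z].
  by have [y [Sy xy _ yP]] := next_abscissa x osc; exists y.
have prev x : exists y, [/\ S y, y < x & forall z, S z -> z < x -> z <= y].
  exact: previous_abscissa.
have [u [hu Su u0 uP]] := enumerate_above 0 next prev.
(* [v] lists the opposites of the abscissas lying below the first positive
   one, from right to left. *)
have [v [hv Sv v0 vP]] : exists v : nat -> R,
    [/\ {homo v : m n / (m < n)%N >-> m < n}, forall n, S (- v n),
        forall n, - u 0%N < v n &
        forall z, S (- z) -> - u 0%N < z -> exists n, v n = z].
  apply: enumerate_above => x.
    have [y [Sy yx yP]] := prev (- x); exists (- y); rewrite opprK ltrNr.
    by split => // z Sz xz; rewrite lerNl yP// ltrNl opprK.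
  have [y [Sy yx yP]] := next (- x); exists (- y); rewrite opprK ltrNl.
  by split => // z Sz xz; rewrite lerNr yP// ltrNr opprK.
have u_le k : u 0%N <= u k.
  by case: k => // k; rewrite ltW// hu.
pose x (m : int) : R := if 0 < m then u `|m|%N.-1 else - v `|m|%N.
have hx : {homo x : k m / k < m}.
  move=> k m km; rewrite /x; case: (ltP 0 k) => k0; case: (ltP 0 m) => m0.
  - by apply: hu; lia.
  - by lia.
  - by apply: lt_le_trans (u_le _); rewrite ltrNl.
  - by rewrite ltrN2; apply: hv; lia.
exists x; split => //.
- apply/seteqP; split=> [_ [m _ <-]|c Sc].
    by rewrite /x; case: ifP => _; [exact: Su|exact: Sv].
  have [c_lt|c_ge] := ltP c (u 0%N).
    have [n nc] := vP (- c) ltac:(by rewrite opprK) ltac:(by rewrite ltrN2).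
    exists (- n%:Z) => //; rewrite /x ifF; last by apply/negbTE; lia.
    by rewrite abszN /= nc opprK.
  have [n nc] := uP c Sc (lt_le_trans (u0 _) c_ge).
  by exists n.+1%:Z.
- exact: u0.
- by move=> a Sa a0; have [n <-] := uP a Sa a0.
Qed.

Lemma infsupumP (R : realType) (f : R -> R) :
  oscillating f -> infsupum_numbering f (infsupum f).
Proof. by move=> osc; apply: xgetPex; exact: infsupum_numbering_exists. Qed.

Lemma infsupum_lt (R : realType) (f : R -> R) (b : int) :
  oscillating f -> infsupum f (b - 1) < infsupum f b.
Proof. by move=> /infsupumP[h _ _ _]; apply: h; lia. Qed.

(** [f] is monotonic up to the next abscissa after [infsupum f (b - 1)], which
    has a number exceeding [b - 1], hence is at least [infsupum f b]. *)
Lemma branch_monotonic (R : realType) (f : R -> R) (b : int) : oscillating f ->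
  monotonic_on f `[infsupum f (b - 1), infsupum f b].
Proof.
move=> osc; have [hx rx _ _] := infsupumP osc.
have [y [Sy xy my _]] := next_abscissa (infsupum f (b - 1)) osc.
apply: monotonic_onS my => z /=; rewrite !in_itv /= => /andP[-> zb] /=.
apply: le_trans zb _; rewrite -rx in Sy; have [m _ ym] := Sy.
rewrite -ym leNgt; apply/negP => mb.
have mono := leW_mono (le_mono hx).
by move: xy mb; rewrite -ym !mono; lia.
Qed.

(** The branch containing [y] is the one that ends at the next abscissa [t]
    after [y]. *)
Lemma branch_cover (R : realType) (f : R -> R) (y : R) : oscillating f ->
  exists b, y \in branch f b.
Proof.
move=> osc; have [hx rx _ _] := infsupumP osc.
have [t [St yt _ tP]] := next_abscissa y osc.
have [b _ bt] : range (infsupum f) t by rewrite rx.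
exists b; rewrite in_itv /= bt yt andbT leNgt; apply/negP => yb.
have Sb : infsupum_abscissas f (infsupum f (b - 1)) by rewrite -rx; exists (b - 1).
by have := tP _ Sb yb; rewrite -bt leNgt infsupum_lt.
Qed.

Lemma oscillating_monotonic_inj (R : realType) (f : R -> R) (I : interval R) :
  oscillating f -> monotonic_on f I -> {in I &, injective f}.
Proof.
move=> osc mI.
have neq x y : x \in I -> y \in I -> x < y -> f x <> f y.
  move=> xI yI xy fxy; have [u [v [xu uv vy /eqP]]] := oscillating_neq osc xy.
  have uI : u \in I by apply: (itv_convex xI yI); lra.
  have vI : v \in I by apply: (itv_convex xI yI); lra.
  apply; apply/eqP; rewrite eq_le; move/monotonic_onP: mI => [h|h].
    by rewrite h ?(ltW uv)//= (le_trans (h _ _ _ _ vy))// -fxy h.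
  by rewrite [f v <= _]h ?(ltW uv)//= andbT (le_trans (h _ _ _ _ xu))// fxy h.
move=> x y xI yI fxy; apply/eqP; case: ltgtP => // xy.
  by case: (neq x y).
by case: (neq y x).
Qed.

Lemma mem_directed_itv (R : realType) (f : R -> R) (a b x : R) :
  monotonic_on f `[a, b] -> {in `[a, b] &, injective f} -> x \in `[a, b[ ->
  f x \in directed_itv (f a) (f b).
Proof.
move=> mf inj; rewrite in_itv /= => /andP[ax xb].
have xI : x \in `[a, b] by rewrite in_itv /= ax ltW.
have aI : a \in `[a, b] by rewrite in_itv /= lexx (le_trans ax (ltW xb)).
have bI : b \in `[a, b] by rewrite in_itv /= lexx (le_trans ax (ltW xb)).
have fxb : f x != f b by apply/eqP => /(inj _ _ xI bI) E; rewrite E ltxx in xb.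
have fab : f a != f b.
  by apply/eqP => /(inj _ _ aI bI) E; move: (le_lt_trans ax xb); rewrite E ltxx.
have ab := le_trans ax (ltW xb).
rewrite /directed_itv; move/monotonic_onP: mf => [h|h].
  by rewrite h// in_itv /= h//= lt_neqAle fxb h// ltW.
rewrite leNgt lt_neqAle eq_sym fab h//= in_itv /= lt_neqAle eq_sym fxb.
by rewrite !h// ltW.
Qed.

Lemma directed_itv_IVT (R : realType) (f : R -> R) (a b c : R) :
  continuous f -> a <= b -> c \in directed_itv (f a) (f b) ->
  exists2 x, x \in `[a, b[ & f x = c.
Proof.
move=> cf ab cI.
have [cab cb] : Num.min (f a) (f b) <= c <= Num.max (f a) (f b) /\ c != f b.
  move: cI; rewrite /directed_itv; case: (leP (f a) (f b)) => fab;
    rewrite in_itv /= => /andP[h1 h2].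
    by rewrite h1 (ltW h2) lt_eqF.
  by rewrite (ltW h1) h2 gt_eqF.
have [x xI fx] := IVT ab (continuous_subspaceT cf) cab; exists x => //.
move: xI; rewrite !in_itv /= => /andP[-> xb] /=; rewrite lt_neqAle xb andbT.
by apply: contraNneq cb => xb'; rewrite -fx xb'.
Qed.

(** On the closure of a branch [f] is monotonic and injective, so [f] maps the
    branch bijectively onto the interval directed from the value at its left end
    to the value at its right end. *)
Lemma oscillating_solutions (R : realType) (f : R -> R) (c : R) :
  oscillating f ->
  [set x | f x = c] = [set branch_inverse b f c | b in solution_branches f c].
Proof.
move=> osc.
have inj b := oscillating_monotonic_inj osc (branch_monotonic b osc).
have sub b x : x \in branch f b -> x \in `[infsupum f (b - 1), infsupum f b].
  by rewrite !in_itv /= => /andP[-> /ltW].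
have invP b x : x \in branch f b -> f x = c -> branch_inverse b f c = x.
  move=> xb fx.
  have [] : unique (fun y => y \in branch f b /\ f y = c) (branch_inverse b f c).
    rewrite /branch_inverse.
    apply: (@xgetPex _ 0 [set x | unique (fun y => y \in branch f b /\ f y = c) x]).
    exists x; split=> // y [yb fy]; apply: (inj b); rewrite ?sub//.
    by rewrite fx fy.
  by move=> _; apply.
apply/seteqP; split=> [x fx|_ [b cb <-]].
- have [b xb] := branch_cover x osc; exists b; last exact: invP.
  rewrite /solution_branches /= -fx; apply: mem_directed_itv => //.
  exact: branch_monotonic.
- have [cf _ _ _] := osc.
  have [x xb fx] := directed_itv_IVT cf (ltW (infsupum_lt b osc)) cb.
  by rewrite /= (invP b x).
Qed.

(** * The entire functions behind the spherical Bessel functions *)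

(** Coefficients of the n-th derivative of sum_k (-1)^k u^k / (2k+1)!. *)
Definition bessel_coef (R : realType) (n k : nat) : R :=
  (-1) ^+ (k + n) * (k + n)`!%:R / (k`! * (k + n).*2.+1`!)%:R.

Definition bessel_series (R : realType) (n : nat) (u : R) : R :=
  limn (pseries (bessel_coef R n) u).

Lemma natf_neq0 (R : realType) (m : nat) : m.+1%:R != 0 :> R.
Proof. by rewrite pnatr_eq0. Qed.

Lemma fact_neq0 (R : realType) (m : nat) : m`!%:R != 0 :> R.
Proof. by rewrite pnatr_eq0 -lt0n fact_gt0. Qed.

Lemma bessel_coef_diffs (R : realType) (n : nat) :
  pseries_diffs (bessel_coef R n) = bessel_coef R n.+1.
Proof.
apply/funext => k; rewrite /pseries_diffs /bessel_coef addSnnS.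
rewrite (natrM _ k.+1`!) (natrM _ k`!) (factS k) natrM.
have := fact_neq0 R (k + n.+1).*2.+1; have := fact_neq0 R k.
have := natf_neq0 R k.
move: (_.*2.+1`!%:R) (k`!%:R) (k.+1%:R) ((k + n.+1)`!%:R) ((-1) ^+ _).
by move=> a b c d e *; field; apply/and3P; split.
Qed.

Lemma bessel_coef_succ (R : realType) (n k : nat) :
  (4 * k + 4 * n + 6)%:R * bessel_coef R n.+1 k = - bessel_coef R n k.
Proof.
rewrite /bessel_coef (addnS k n) doubleS (factS (k + n)) exprS.
rewrite (factS (k + n).*2.+2) (factS (k + n).*2.+1) !(natrM _ k`!).
rewrite !(natrM _ _.+1).
have -> : (4 * k + 4 * n + 6)%:R = 2 * (k + n).*2.+3%:R :> R.
  by rewrite -natrM; congr (_%:R); rewrite -addnn; ring.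
have -> : (k + n).*2.+2%:R = 2 * (k + n).+1%:R :> R.
  by rewrite -natrM -doubleS -mul2n.
have := fact_neq0 R (k + n).*2; have := fact_neq0 R k.
have := natf_neq0 R (k + n); have := natf_neq0 R (k + n).*2.
have := natf_neq0 R (k + n).*2.+2.
move: (_.*2`!%:R) (_.+1%:R) (_.*2.+1%:R) (_.*2.+3%:R) (k`!%:R)
  ((k + n)`!%:R) ((-1) ^+ _).
by move=> a b c d e f g *; field; apply/and5P; split.
Qed.

(** Domination by the exponential series: (k+n)! <= (2(k+n)+1)!. *)
Lemma bessel_coef_le (R : realType) (n k : nat) :
  `|bessel_coef R n k| <= k`!%:R^-1.
Proof.
rewrite /bessel_coef normrM normfV normrM normrX normrN1 expr1n mul1r.
rewrite !ger0_norm// natrM invfM mulrC -mulrA ler_piMr ?invr_ge0//.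
rewrite mulrC ler_pdivrMr ?ltr0n ?fact_gt0// mul1r ler_nat.
by apply: leq_fact; rewrite -addnn -addnS leq_addr.
Qed.

Lemma is_cvg_bessel_series (R : realType) (n : nat) (u : R) :
  cvgn (pseries (bessel_coef R n) u).
Proof.
apply: normed_cvg; rewrite /normed_series_of /=.
have := is_cvg_series_exp_coeff `|u|; apply: series_le_cvg => [k|k|k] //.
  by rewrite exp_coeff_ge0.
rewrite /exp_coeff /= normrM normrX mulrC.
by rewrite ler_wpM2l ?exprn_ge0// bessel_coef_le.
Qed.

Lemma is_derive_bessel_series (R : realType) (n : nat) (u : R) :
  is_derive u (1 : R) (bessel_series n) (bessel_series n.+1 u).
Proof.
rewrite /bessel_series -bessel_coef_diffs.
apply: (@pseries_snd_diffs _ _ (`|u| + 1)); rewrite ?bessel_coef_diffs;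
  try exact: is_cvg_bessel_series.
by rewrite [ltRHS]ger0_norm ?addr_ge0// ltrDl.
Qed.

(** As [bessel_series n.+1] and [bessel_series n.+2] are the first two
    derivatives of [bessel_series n], this is the differential equation
    4 u y'' + (4 n + 6) y' + y = 0.  The k-th terms of the three series cancel
    by [bessel_coef_succ]. *)
Lemma bessel_series_ode (R : realType) (n : nat) (u : R) :
  4 * u * bessel_series n.+2 u + (4 * n + 6)%:R * bessel_series n.+1 u
  + bessel_series n u = 0.
Proof.
have cK m := @is_cvg_bessel_series R m u.
have /= := @pseries_diffs_equiv R (bessel_coef R n.+1) u.
rewrite bessel_coef_diffs => /(_ (cK _)); rewrite -/(bessel_series _ _) => c2.
have c1 : pseries (bessel_coef R n.+1) u @ \oo --> bessel_series n.+1 u := cK _.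
have c0 : pseries (bessel_coef R n) u @ \oo --> bessel_series n u := cK _.
have := cvgD (cvgD (cvgMl_tmp (a := 4 * u) c2)
  (cvgMl_tmp (a := (4 * n + 6)%:R) c1)) c0.
move=> cs; rewrite -(cvg_lim (@Rhausdorff R) (cs _ _ _ _)).
apply: (cvg_lim (@Rhausdorff R)).
apply: cvg_near_cst; apply: nearW => N; rewrite /pseries /series /= !fctE.
rewrite !mulr_sumr -!big_split/= big1// => k _.
suff -> : bessel_coef R n k = - ((4 * k + 4 * n + 6)%:R * bessel_coef R n.+1 k).
  case: k => [|k].
    by rewrite !mul0r mulr0 add0r muln0 add0n mulrA mulNr subrr.
  by rewrite [u ^+ k.+1]exprS !natrD !natrM /=; ring.
by rewrite bessel_coef_succ opprK.
Qed.

Lemma sin_bessel_series (R : realType) (x : R) :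
  sin x = x * bessel_series 0 (x ^+ 2).
Proof.
have E : series (sin_coeff' x) =
    fun N => x * pseries (bessel_coef R 0) (x ^+ 2) N.
  apply/funext => N; rewrite /pseries /series /= mulr_sumr.
  apply: eq_bigr => k _.
  rewrite /sin_coeff' /bessel_coef addn0 natrM -exprnP exprS -mul2n exprM.
  by field; rewrite !fact_neq0.
rewrite -(cvg_lim (@Rhausdorff R) (@cvg_sin_coeff' R x)) E.
apply: (cvg_lim (@Rhausdorff R)); apply: cvgMl_tmp.
exact: is_cvg_bessel_series.
Qed.

Lemma is_derive_bessel_series_sqr (R : realType) (n : nat) (x : R) :
  is_derive x (1 : R) (fun y => bessel_series n (y ^+ 2))
    (2 * x * bessel_series n.+1 (x ^+ 2)).
Proof.
have dsq : is_derive x (1 : R) (fun y : R => y ^+ 2) (2 * x).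
  by apply: is_derive_eq; rewrite /GRing.scale /=; ring.
rewrite mulrC.
exact: (is_derive1_comp (g := fun y => y ^+ 2)
  (is_derive_bessel_series n (x ^+ 2)) dsq).
Qed.

Lemma cos_bessel_series (R : realType) (x : R) :
  cos x = bessel_series 0 (x ^+ 2) + 2 * x ^+ 2 * bessel_series 1 (x ^+ 2).
Proof.
have dsin : is_derive x (1 : R) sin (cos x) by exact: is_derive_sin.
have dK := is_derive_bessel_series_sqr 0 x.
have dprod := is_deriveM (is_derive_id x (1 : R)) dK.
have E : sin = id * (fun y : R => bessel_series 0 (y ^+ 2)).
  by apply/funext => y; rewrite sin_bessel_series.
rewrite -(@derive_val _ _ _ _ _ _ _ dsin) E (@derive_val _ _ _ _ _ _ _ dprod).
by rewrite /GRing.scale /=; ring.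
Qed.

(** The differential equation propagates a common zero of two consecutive
    functions down to the first two, which vanish together only if sin x and
    cos x do. *)
Lemma bessel_series_no_double_zero (R : realType) (n : nat) (x : R) :
  bessel_series n (x ^+ 2) = 0 -> bessel_series n.+1 (x ^+ 2) <> 0.
Proof.
elim: n => [|n IHn] K0 K1.
  have := cos2Dsin2 x; rewrite cos_bessel_series sin_bessel_series K0 K1.
  by rewrite !mulr0 addr0 expr0n /= addr0 => /esym/eqP; rewrite oner_eq0.
apply: IHn => //; have := bessel_series_ode n (x ^+ 2).
by rewrite K0 K1 !mulr0 !add0r.
Qed.

(** * Critical points and zeros *)

(** Each zero near [a] gives by Rolle's theorem a still nearer zero of the
    derivative. *)
Lemma limit_point_zeros (R : realType) (g g' : R -> R) (a : R) :
  (forall x, is_derive x (1 : R) g (g' x)) ->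
  limit_point [set x | g x = 0] a ->
  g a = 0 /\ limit_point [set x | g' x = 0] a.
Proof.
move=> dg la.
have cg x : {for x, continuous g}.
  by apply/differentiable_continuous/derivable1_diffP; case: (dg x).
have ga : g a = 0.
  apply: contrapT => /eqP ga; have [y [_ gy]] := la _ (cvgr_neq0 _ (cg a) ga).
  by rewrite gy eqxx.
split=> // U /nbhs_ballP[e e0 eU].
have [y [ya gy ey]] := la _ (nbhsx_ballx a e e0).
have rolle (s t : R) : s < t -> g s = 0 -> g t = 0 ->
    exists2 z, s < z < t & g' z = 0.
  move=> st gs gt; have [|||z] := @Rolle R g s t st.
  - by move=> z _; case: (dg z).
  - by apply: continuous_subspaceT => z; exact: cg.
  - by rewrite gs gt.
  rewrite in_itv /= => zst dz; exists z => //.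
  by rewrite -(@derive_val _ _ _ _ _ _ _ (dg z)) (@derive_val _ _ _ _ _ _ _ dz).
rewrite /ball /= in ey eU.
have [ya'|ay|ya0] := ltgtP y a; last by rewrite ya0 eqxx in ya.
- have [z /andP[yz za] gz] := rolle _ _ ya' gy ga.
  exists z; split; rewrite ?(lt_eqF za)//; apply: eU; move: ey.
  rewrite /= !gtr0_norm ?subr_gt0// !ltrBlDr => /lt_le_trans-> //.
  by rewrite lerD2l ltW.
- have [z /andP[az zy] gz] := rolle _ _ ay ga gy.
  exists z; split; rewrite ?(gt_eqF az)//; apply: eU; move: ey.
  by rewrite /= !ltr0_norm ?subr_lt0// !opprB; apply: lt_trans; rewrite ltrD2r.
Qed.

(** The factor of the derivative of x^n K_n(x^2), n x^(n-1) K_n(x^2) +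
    2 x^(n+1) K_{n+1}(x^2), that remains when x^(n-1) is taken out, as a
    function of u = x^2. *)
Definition bessel_slope (R : realType) (n : nat) (u : R) : R :=
  n%:R * bessel_series n u + 2 * u * bessel_series n.+1 u.

(** The derivative has the shape of the function, with [n] and [c] replaced by
    [n.+1] and [c + 2]; so the lemma also yields all higher derivatives of
    [bessel_slope n], for which [c] starts at [n]. *)
Lemma is_derive_scaled_sum (R : realType) (n : nat) (c u : R) :
  is_derive u (1 : R)
    (fun v => c * bessel_series n v + 2 * v * bessel_series n.+1 v)
    ((c + 2) * bessel_series n.+1 u + 2 * u * bessel_series n.+2 u).
Proof.
have d0 := is_derive_bessel_series n u.
have d1 := is_derive_bessel_series n.+1 u.
by apply: is_derive_eq; rewrite /GRing.scale /=; ring.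
Qed.

(** At a point of accumulation the slope and its first two derivatives vanish.
    With the differential equation at orders [n] and [n.+1] these are linear
    relations between four consecutive functions that leave only
    K_n = K_{n+1} = 0. *)
Lemma bessel_slope_isolated (R : realType) (n : nat) (x : R) :
  ~ limit_point [set u | bessel_slope n u = 0] (x ^+ 2).
Proof.
move=> /(limit_point_zeros (is_derive_scaled_sum n n%:R))[G0].
move=> /(limit_point_zeros (is_derive_scaled_sum n.+1 _))[G1].
move=> /(limit_point_zeros (is_derive_scaled_sum n.+2 _))[G2 _].
have E0 := bessel_series_ode n (x ^+ 2).
have E1 := bessel_series_ode n.+1 (x ^+ 2).
suff [K0 K1] : bessel_series n (x ^+ 2) = 0 /\ bessel_series n.+1 (x ^+ 2) = 0.
  exact: bessel_series_no_double_zero K0 K1.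
move: (x ^+ 2) (bessel_series n _) (bessel_series n.+1 _)
  (bessel_series n.+2 _) (bessel_series n.+3 _) G0 G1 G2 E0 E1.
move=> a k0 k1 k2 k3; rewrite /bessel_slope !natrD !natrM -[n.+1%:R]natr1.
have : 0 <= n%:R :> R by rewrite ler0n.
move: (n%:R : R) => m m0 G0 G1 G2 E0 E1.
(* The first two relations below are G'' and G' with the term in [a]
   eliminated by the differential equation. *)
have k1E : k1 = - (2 * m + 2) * k2 by lra.
have k0E : k0 = - (2 * m + 2) * k1 by lra.
have k20 : (2 * m + 2) ^+ 2 * k2 = 0.
  have -> : (2 * m + 2) ^+ 2 * k2 = - 2^-1 * ((m * k0 + 2 * a * k1) +
      (2 * m + 2) * ((m + 2) * k1 + 2 * a * k2)) by rewrite k0E k1E; field.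
  by rewrite G0 G1 mulr0 addr0 mulr0.
have {}k20 : k2 = 0.
  move/eqP: k20; rewrite mulf_eq0 expf_eq0 /= => /orP[/eqP|/eqP//]; lra.
by rewrite k0E k1E k20 !mulr0.
Qed.

(** This is j_n, in a form that makes sense at 0. *)
Definition bessel_entire (R : realType) (n : nat) (x : R) : R :=
  (- (2 * x)) ^+ n * bessel_series n (x ^+ 2).

Lemma spherical_besselE (R : realType) (n : nat) :
  spherical_bessel n = @bessel_entire R n.
Proof.
have iterE m (y : R) : y != 0 ->
    iter m (fun (f : R -> R) z => z^-1 * derive1 f z) (fun z => sin z / z) y =
    2 ^+ m * bessel_series m (y ^+ 2).
  elim: m y => [|m IHm] y y0.
    by rewrite /= sin_bessel_series mulrAC divff// mul1r.
  rewrite iterS derive1E.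
  have dK := is_deriveZ (2 ^+ m) (is_derive_bessel_series_sqr m y).
  rewrite (near_eq_derive (g := 2 ^+ m \*: fun z => bessel_series m (z ^+ 2))).
    by rewrite (@derive_val _ _ _ _ _ _ _ dK) /GRing.scale /= (exprS 2 m); field.
  have ny : \forall z \near y, z != 0.
    by exact: (cvgr_neq0 _ (@cvg_id _ (nbhs y)) y0).
  by near=> z; rewrite IHm //; near: z.

apply/funext => x; rewrite /spherical_bessel /bessel_entire.
have [->|x0] := eqVneq x 0.
  rewrite mulr0 oppr0 expr0n /=.
  case: eqP => [->|_]; last by rewrite mul0r.
  have := cos_bessel_series (0 : R).
  by rewrite cos0 expr0n /= mulr0 mul0r addr0 mul1r.
by rewrite iterE// mulrA -exprMn; congr (_ ^+ _ * _); ring.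
Unshelve. all: by end_near. Qed.

Lemma is_derive_bessel_entire (R : realType) (n : nat) (x : R) :
  is_derive x (1 : R) (bessel_entire n)
    (- 2 * n%:R * (- (2 * x)) ^+ n.-1 * bessel_series n (x ^+ 2)
     + (- (2 * x)) ^+ n * (2 * x * bessel_series n.+1 (x ^+ 2))).
Proof.
have dK := is_derive_bessel_series_sqr n x.
have dl : is_derive x (1 : R) (fun y => - (2 * y)) (- 2).
  by apply: is_derive_eq; rewrite /GRing.scale /=; ring.
have -> : bessel_entire n =
    (fun y : R => - (2 * y)) ^+ n * (fun y => bessel_series n (y ^+ 2)).
  by apply/funext => y; rewrite !fctE.
apply: (is_derive_eq (is_deriveM (is_deriveX n dl) dK)).
rewrite !fctE /GRing.scale /=; ring.
Qed.

Lemma is_derive_bessel_entire_neq0 (R : realType) (n : nat) (x : R) : x != 0 ->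
  is_derive x (1 : R) (bessel_entire n)
    ((- (2 * x)) ^+ n / x * bessel_slope n (x ^+ 2)).
Proof.
move=> x0; apply: is_derive_eq; first exact: is_derive_bessel_entire.
rewrite /bessel_slope; case: n => [|n]; first by rewrite !expr0 mulr0n /=; field.
by rewrite (exprS _ n) /= -natr1; field.
Qed.

(** Squares of critical points accumulating at [a] would be zeros of the slope
    accumulating at [a ^+ 2]. *)
Lemma bessel_entire_critical_isolated (R : realType) (n : nat) (a : R) :
  exists2 e, 0 < e & forall x d, x != a -> `|x - a| < e ->
    is_derive x (1 : R) (bessel_entire n) d -> d != 0.
Proof.
apply: contrapT => noe; apply: (@bessel_slope_isolated R n a) => U Ua.
have sqa : \forall x \near a, U (x ^+ 2).
  have : {for a, continuous (fun x : R => x ^+ 2)} by exact: exprn_continuous.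
  exact.
have ne b : b != a -> \forall x \near a, x != b.
  move=> ba; have : \forall x \near a, x - b != 0.
    have c : x - b @[x --> a] --> a - b.
      by apply: cvgB; [exact: cvg_id|exact: cvg_cst].
    by apply: (cvgr_neq0 _ c); rewrite subr_eq0 eq_sym.
  by apply: filterS => x; rewrite subr_eq0.
(* Excluding 0 and [- a] ensures that [x] is covered by the formula for the
   derivative away from 0 and that [x ^+ 2] differs from [a ^+ 2]. *)
have [e e0 he] : exists2 e, 0 < e & forall x, x != a -> `|x - a| < e ->
    [/\ U (x ^+ 2), x != 0 & x != - a].
  have : \forall x \near a, x != a -> [/\ U (x ^+ 2), x != 0 & x != - a].
    have [a0|a0] := eqVneq a 0.
      by apply: filterS sqa => x Ux; rewrite a0 oppr0 => x0; split.
    have aNa : - a != a by rewrite -subr_eq0 -opprD oppr_eq0 -mulr2n mulrn_eq0.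
    have a0' : 0 != a by rewrite eq_sym.
    near=> x => _; split; near: x; [exact: sqa|exact: ne|exact: ne].
  move=> /nbhs_ballP[e e0 he]; exists e => // x xa xe; apply: he => //.
  by rewrite /ball /= distrC.
apply: contrapT => nox; apply: noe; exists e => // x d xa xe dx.
apply/eqP => d0; apply: nox; have [Ux x0 xNa] := he x xa xe.
exists (x ^+ 2); split => //.
  by rewrite eqf_sqr (negbTE xa).
have dx' := is_derive_bessel_entire_neq0 n x0.
have := @derive_val _ _ _ _ _ _ _ dx'; rewrite (@derive_val _ _ _ _ _ _ _ dx) d0.
move/esym/eqP; rewrite !mulf_eq0 invr_eq0 expf_eq0 oppr_eq0 mulf_eq0.
by rewrite (negbTE x0) pnatr_eq0 !andbF /= => /eqP.
Unshelve. all: by end_near. Qed.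

Lemma bessel_entire_locally_injective (R : realType) (n : nat) (a : R) :
  exists2 e, 0 < e & {in `[a, a + e] &, injective (@bessel_entire R n)} /\
                     {in `[a - e, a] &, injective (@bessel_entire R n)}.
Proof.
have [e e0 he] := bessel_entire_critical_isolated n a.
have inj (s t : R) : s < t -> bessel_entire n s = bessel_entire n t ->
    exists2 z, s < z < t & e <= `|z - a| \/ z = a.
  move=> st fst; have [|||z] := @Rolle R (bessel_entire n) s t st.
  - by move=> z _; case: (is_derive_bessel_entire n z).
  - apply: continuous_subspaceT => z.
    apply/differentiable_continuous/derivable1_diffP.
    by case: (is_derive_bessel_entire n z).
  - by [].
  rewrite in_itv /= => zst dz; exists z => //.
  have [->|za] := eqVneq z a; first by right.
  by left; rewrite leNgt; apply/negP => ze; have := he _ _ za ze dz; rewrite eqxx.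
exists (e / 2); first by rewrite divr_gt0.
have H s t : s < t -> bessel_entire n s = bessel_entire n t ->
    ~ (a <= s /\ t <= a + e / 2) /\ ~ (a - e / 2 <= s /\ t <= a).
  move=> st /(inj _ _ st)[z /andP[sz zt]] hz; split=> -[sa ta].
    case: hz => [|za]; last by lra.
    by rewrite gtr0_norm; lra.
  case: hz => [|za]; last by lra.
  by rewrite ltr0_norm; lra.
split=> s t; rewrite !in_itv /= => /andP[s1 s2] /andP[t1 t2] fst.
- case: (ltgtP s t) => // st; first by case: (H _ _ st fst) => -[].
  by case: (H _ _ st (esym fst)) => -[].
- case: (ltgtP s t) => // st; first by case: (H _ _ st fst) => _ [].
  by case: (H _ _ st (esym fst)) => _ [].
Qed.

(** Induction on [n] by Rolle's theorem, starting from the zeros (k pi)^2 of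
    sin (sqrt u) / sqrt u. *)
Lemma bessel_series_zeros_unbounded (R : realType) (n : nat) (M : R) :
  exists2 u, M < u & bessel_series n u = 0.
Proof.
elim: n M => [|n IHn] M.
  pose k := Num.bound M; have kM : M < k.+1%:R.
    by rewrite (lt_le_trans (unstable.ltr_bound M))// ler_nat.
  have k1 : 1 <= k.+1%:R :> R by rewrite ler1n.
  have pik : k.+1%:R <= (pi : R) *+ k.+1.
    rewrite -[pi *+ _]mulr_natr ler_peMl ?ler0n//.
    by rewrite (le_trans _ (pi_ge2 R))// ler1n.
  exists ((pi *+ k.+1) ^+ 2); first by nra.
  have := alternatingn (@sinDpi R) k.+1 0.
  rewrite add0r sin0 mulr0 sin_bessel_series => /eqP; rewrite mulf_eq0.
  by case/orP=> /eqP // ppi0; lra.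
have [s Ms Ks] := IHn M; have [t st Kt] := IHn s.
have [|||z] := @Rolle R (bessel_series n) s t st.
- by move=> z _; case: (is_derive_bessel_series n z).
- apply: continuous_subspaceT => z.
  apply/differentiable_continuous/derivable1_diffP.
  by case: (is_derive_bessel_series n z).
- by rewrite Ks.
rewrite in_itv /= => /andP[sz _] dz; exists z; first exact: lt_trans sz.
rewrite -(@derive_val _ _ _ _ _ _ _ (is_derive_bessel_series n z)).
by rewrite (@derive_val _ _ _ _ _ _ _ dz).
Qed.

Lemma bessel_entire_zeros_unbounded (R : realType) (n : nat) (M : R) :
  exists2 x, M < x & bessel_entire n x = 0 /\ bessel_entire n (- x) = 0.
Proof.
have [u Mu Ku] := bessel_series_zeros_unbounded n (M ^+ 2).
have u0 : 0 <= u by rewrite (le_trans (sqr_ge0 M))// ltW.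
exists (Num.sqrt u); last first.
  by rewrite /bessel_entire sqrrN sqr_sqrtr// Ku !mulr0.
rewrite (le_lt_trans (ler_norm M))// -sqrtr_sqr ltr_sqrt//.
exact: le_lt_trans (sqr_ge0 M) Mu.
Qed.

Lemma monotonic_on_const (R : realType) (f : R -> R) (I : interval R)
    (x m y : R) :
  monotonic_on f I -> x \in I -> y \in I -> x <= m -> m <= y -> f x = f y ->
  f m = f x.
Proof.
move=> /monotonic_onP mI xI yI xm my fxy.
have mem := itv_convex xI yI xm my.
apply/eqP; rewrite eq_le; case: mI => h.
  by rewrite [f x <= _]h// andbT fxy h.
by rewrite h//= fxy h.
Qed.

(** A half-line contains two zeros further apart than the length of local
    injectivity at one of them; monotonicity would make the function constant
    between the two. *)
Lemma bessel_entire_oscillating (R : realType) (n : nat) :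
  oscillating (@bessel_entire R n).
Proof.
split.
- move=> x; apply/differentiable_continuous/derivable1_diffP.
  by case: (is_derive_bessel_entire n x).
- exact: bessel_entire_locally_injective.
- move=> a mono; have [z az [fz _]] := bessel_entire_zeros_unbounded n a.
  have [e e0 [inj _]] := bessel_entire_locally_injective n z.
  have [y ey [fy _]] := bessel_entire_zeros_unbounded n (z + e).
  have fze : bessel_entire n (z + e) = bessel_entire n z.
    by apply: (@monotonic_on_const _ _ _ z _ y mono);
      rewrite ?in_itv /= ?andbT ?fz ?fy//; lra.
  have E : z + e = z by apply: (inj _ _ _ _ fze); rewrite in_itv /=; lra.
  by lra.
- move=> a mono; have [z az [_ fz]] := bessel_entire_zeros_unbounded n (- a).
  have [e e0 [_ inj]] := bessel_entire_locally_injective n (- z).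
  have [y ey [_ fy]] := bessel_entire_zeros_unbounded n (z + e).
  have fze : bessel_entire n (- z - e) = bessel_entire n (- y).
    by apply: (@monotonic_on_const _ _ _ (- y) _ (- z) mono);
      rewrite ?in_itv /= ?fz ?fy//; lra.
  have E : - z - e = - z.
    by apply: (inj _ _ _ _ (etrans fze _)); rewrite ?fz ?fy// in_itv /=; lra.
  by lra.
Qed.

Theorem proposition2 (R : realType) (n : nat) (c0 : R) (p q : {poly int})
  (hpq : forall x : R, x != 0 ->
     spherical_bessel n x =
       strict_laurent p x * sin x + strict_laurent q x * cos x) :
  [set x : R | (if x == 0 then (if n == 0%N then 1 else 0)
                else strict_laurent p x * sin x + strict_laurent q x * cos x)
               = c0] =
  [set branch_inverse b (spherical_bessel n) c0
     | b in solution_branches (spherical_bessel n) c0].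
Proof.
rewrite -oscillating_solutions; last first.
  by rewrite spherical_besselE; exact: bessel_entire_oscillating.
congr mkset; apply/funext => x; congr (_ = _).
have [->|x0] := eqVneq x 0; first by rewrite /spherical_bessel eqxx.
by rewrite hpq.
Qed.
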